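(* Let $\mathbb{F}$ be a field with $|\mathbb{F}| \geq 3$, let $A \in M_n(\mathbb{F})$, let $\mathcal{B}$ be a linear subspace of $M_n(\mathbb{F})$ contained in $W_n(\mathbb{F})$, and let $\mathcal{S}=A+\mathcal{B}$. Then $\rho(\mathcal{S}) \geq \mu(G_{\mathcal{S}})$.
   Context: $M_n(\mathbb{F})$ is the space of $n\times n$ matrices over $\mathbb{F}$, and $[n]=\{1,\dots,n\}$. A matrix $A=(A(i,j))$ is weakly symmetric if for all $i,j$: $A(i,j)\neq 0$ iff $A(j,i)\neq 0$; $W_n(\mathbb{F})$ denotes the set of weakly symmetric matrices in $M_n(\mathbb{F})$. For a set $\mathcal{S}$ of matrices, $\rho(\mathcal{S})=\max\{\mathrm{rk}(A): A\in\mathcal{S}\}$. Let $\{(i,j)\in[n]^2: i\le j\}$ be ordered colexicographically: $(i,j)\prec(i',j')$ iff $j<j'$, or $j=j'$ and $i<i'$. For $0\neq A\in W_n(\mathbb{F})$, let $q(A)$ be the $\prec$-maximal pair $(i,j)$ with $i\le j$ and $A(i,j)\neq 0$, and if $q(A)=(i,j)$ set $\tilde q(A)=\{i,j\}$ (a set of size 1 or 2). Let $\tilde K_n=\{e\subset[n]: 0<|e|\le 2\}$ (complete graph with loops). For $\mathcal{S}=A+\mathcal{B}$ with $\mathcal{B}\subset W_n(\mathbb{F})$ a linear space, $G_{\mathcal{S}}=\{\tilde q(B): 0\neq B\in\mathcal{B}\}\subset\tilde K_n$. A matching is a subset $M\subset \tilde K_n$ whose members are pairwise disjoint. For $G\subset\tilde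 K_n$, $\mu(G)=\max\sum_{e\in M}|e|$ over all matchings $M\subset G$. *)

(* Defs.v *)
From HB Require Import structures.
From mathcomp Require Import all_boot all_order all_algebra.
From mathcomp Require Import boolp.

Set Implicit Arguments.
Unset Strict Implicit.
Unset Printing Implicit Defensive.

Import Order.TTheory GRing.Theory.

Local Open Scope ring_scope.

(* The index set [n] = {1, ..., n} is rendered by 'I_n = {0, ..., n - 1}. *)

Section Matrices.
Variables (F : fieldType) (n : nat).
Implicit Types (A : 'M[F]_n) (p r : 'I_n * 'I_n).

Definition weakly_symmetric A : Prop :=
  forall i j : 'I_n, A i j != 0 <-> A j i != 0.

Definition affine_set A (B : {vspace 'M[F]_n}) : 'M[F]_n -> Prop :=
  fun X => exists2 Y, Y \in B & X = A + Y.

(* Ranks of n x n matrices are at most n, so bounding the index k loses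
   nothing; for nonempty S this is the maximum of \rank over S. *)
Definition max_rank (S : 'M[F]_n -> Prop) : nat :=
  (\max_(k < n.+1 | `[< exists2 X, S X & \rank X = k >]) k)%N.

Definition colex_lt p r : bool :=
  (p.2 < r.2)%N || (p.2 == r.2) && (p.1 < r.1)%N.

Definition upper_support A : {set 'I_n * 'I_n} :=
  [set p : 'I_n * 'I_n | (p.1 <= p.2)%N && (A p.1 p.2 != 0)].

(* None only when A vanishes on and above the diagonal; see qmaxP. *)
Definition qmax A : option ('I_n * 'I_n) :=
  [pick p in upper_support A |
     [forall r in upper_support A, (r != p) ==> colex_lt r p]].

Definition qtilde A : {set 'I_n} :=
  if qmax A is Some p then [set p.1; p.2] else set0.

(* G_S for S = A + B; it depends only on the direction space B of S. *)
Definition affine_graph (B : {vspace 'M[F]_n}) : {set {set 'I_n}} :=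
  [set e | `[< exists Y, [/\ Y \in B, Y != 0 & qtilde Y = e] >]].

Lemma qmaxP A : weakly_symmetric A -> A != 0 ->
  exists2 p, qmax A = Some p &
    p \in upper_support A /\
    forall r, r \in upper_support A -> r != p -> colex_lt r p.
Proof.
move=> wsA nzA.
have [p0 p0A] : exists p, p \in upper_support A.
  have [i [j Aij]] : exists i j, A i j != 0.
    apply: contrapT => nA; move/eqP: nzA; apply; apply/matrixP => i j.
    rewrite mxE; apply/eqP/negPn/negP => Aij; apply: nA; by exists i, j.
  have [ij|/ltnW ji] := leqP i j; first by exists (i, j); rewrite inE ij.
  by exists (j, i); rewrite inE ji; apply/wsA.
rewrite /qmax; case: pickP => [p /andP[pA /forall_inP pmax]|none].
  by exists p => //; split=> // r rA; apply/implyP/pmax.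
pose w (p : 'I_n * 'I_n) := (p.2 * n + p.1)%N.
case: (@arg_maxnP _ p0 (mem (upper_support A)) w p0A) => p pA pmax.
have /negP[] := negbT (none p); apply/andP; split=> //.
apply/forall_inP => r rA; apply/implyP => rp.
have := pmax r rA; rewrite /w /colex_lt /geq /= => le_rp.
have [//|lt_pr|eq2] := ltngtP (r.2 : nat) p.2.
- have : (p.2.+1 * n + r.1 <= p.2 * n + p.1)%N.
    by apply: leq_trans le_rp; rewrite leq_add2r leq_mul2r lt_pr orbT.
  rewrite mulSn -addnA addnCA leq_add2l => /(leq_trans (leq_addr _ _)).
  by rewrite leqNgt ltn_ord.
- move: le_rp; rewrite eq2 leq_add2l leq_eqVlt -val_eqE /= eq2 eqxx.
  case/orP=> [/eqP eq1|->//]; case/eqP: rp.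
  by case: r p eq1 eq2 {rA pA pmax} => [r1 r2] [p1 p2] /= /val_inj-> /val_inj->.
Qed.

End Matrices.

Section Graphs.
Variable n : nat.

Definition loop_complete : {set {set 'I_n}} :=
  [set e : {set 'I_n} | (0 < #|e| <= 2)%N].

Definition matching (M : {set {set 'I_n}}) : bool :=
  (M \subset loop_complete) && trivIset M.

Definition mu (G : {set {set 'I_n}}) : nat :=
  (\max_(M : {set {set 'I_n}} | (M \subset G) && matching M)
     \sum_(e in M) #|e|)%N.

End Graphs.

(* Main.v *)
Require Import Defs.
From mathcomp Require Import all_boot all_algebra.
From mathcomp Require Import boolp perm.

Set Implicit Arguments.
Unset Strict Implicit.
Unset Printing Implicit Defensive.

Import GRing.Theory.

Local Open Scope ring_scope.

(** Let [M] be a matching in the graph, and for [e] in [M] let [Y e] in [B] be a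
    matrix with leading position [e].  Consider the minor of
    [A + \sum_e x_e Y_e] whose rows are the vertices covered by [M] and whose
    columns are their partners in [M].  It is a polynomial of degree at most
    [#|cover M|], and [\prod_e x_e ^ #|e|] is a monomial of that degree.  Give a
    position [(u, v)] the weight [2 ^ u + 2 ^ v]: sorted pairs are ordered
    colexicographically by weight, so [Y e] has its heaviest nonzero entries
    exactly at its leading position.  Every term of the Leibniz formula
    contributing to that monomial has the same total weight as the diagonal one,
    which is the largest possible, hence it consists of leading entries only and
    is the diagonal term.  So the monomial has a nonzero coefficient, and since
    its exponents are at most 2, the combinatorial Nullstellensatz gives a point
    of a grid with three values per variable where the minor does not vanish. *)

Section CombinatorialNullstellensatz.
Variables (F : fieldType) (T : finType).

Lemma exists_divided_difference (s : seq F) (d : nat) :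
    uniq s -> (d < size s)%N ->
  exists w : nat -> F, forall k, (k <= d)%N ->
    \sum_(j < d.+1) w j * s`_j ^+ k = (k == d)%:R.
Proof.
move=> s_uniq d_lt; pose V := Vandermonde d.+1 (\row_(j < d.+1) s`_j).
have ltn_size (j : 'I_d.+1) : (j < size s)%N by apply: leq_trans d_lt.
have V_unit : V \in unitmx.
  rewrite unitmxE unitfE det_Vandermonde; apply/prodf_neq0 => i _.
  apply/prodf_neq0 => j lt_ij.
  by rewrite !mxE subr_eq0 nth_uniq ?gtn_eqF.
exists (fun j => invmx V (inord j) ord_max) => k; rewrite -ltnS => k_lt.
transitivity ((V *m invmx V) (Ordinal k_lt) ord_max).
  by rewrite mxE; apply: eq_bigr => j _; rewrite mxE mxE inord_val mulrC.
by rewrite mulmxV // mxE.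
Qed.

Lemma exists_lt_of_sum_le (a d : {ffun T -> nat}) :
  a != d -> (\sum_e a e <= \sum_e d e)%N -> exists e, (a e < d e)%N.
Proof.
move=> neq_ad; apply: contraPP => no_lt; apply/negP; rewrite -ltnNge.
have le_da e : true -> (d e <= a e ?= iff (d e == a e))%N.
  move=> _; split=> //; rewrite leqNgt.
  by apply/negP => lt_ad; apply: no_lt; exists e.
rewrite ltn_neqAle !(leqif_sum le_da) andbT.
apply: contra neq_ad => /forallP eq_da.
by apply/eqP/ffunP => e; rewrite (eqP (eq_da e)).
Qed.

(* Polynomials are given as sums of terms [c i] times the monomial of exponent
   [a i], where distinct [i] may carry the same exponent. *)
Lemma combinatorial_nullstellensatz (I : finType) (c : I -> F)
    (a : I -> {ffun T -> nat}) (d : {ffun T -> nat}) (s : T -> seq F) :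
    (forall e, uniq (s e)) -> (forall e, d e < size (s e))%N ->
    (forall i, \sum_e a i e <= \sum_e d e)%N ->
    \sum_(i | a i == d) c i != 0 ->
  exists2 x : T -> F, forall e, x e \in s e &
    \sum_i c i * \prod_e x e ^+ a i e != 0.
Proof.
move=> s_uniq d_lt a_le; apply: contraNP => no_x.
have /fin_all_exists[w wP] e := exists_divided_difference (s_uniq e) (d_lt e).
pose N := (\max_e (d e).+1)%N.
pose in_grid e : pred 'I_N := fun j => (j < (d e).+1)%N.
pose x (g : {ffun T -> 'I_N}) e := (s e)`_(g e).
have sum_in_grid e (G : nat -> F) :
    \sum_(j | in_grid e j) G j = \sum_(j < (d e).+1) G j.
  by rewrite (big_ord_widen N G) // (@leq_bigmax _ (fun e => (d e).+1)).
have functional_monomial i :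
    \sum_(g in family in_grid) \prod_e w e (g e) * \prod_e x g e ^+ a i e =
    (a i == d)%:R.
  under eq_bigr do rewrite -big_split.
  rewrite -(bigA_distr_big_dep in_grid
    (fun e (j : 'I_N) => w e j * (s e)`_j ^+ a i e)).
  under eq_bigr do rewrite (sum_in_grid _ (fun j => w _ j * (s _)`_j ^+ a i _)).
  have [ad|neq_ad] := eqVneq (a i) d.
    by rewrite big1 // => e _; rewrite wP ad ?eqxx.
  have [e lt_e] := exists_lt_of_sum_le neq_ad (a_le i).
  by rewrite (bigD1 e) //= wP ?ltn_eqF ?mul0r // ltnW.
apply/eqP; transitivity (\sum_i \sum_(g in family in_grid)
    \prod_e w e (g e) * (c i * \prod_e x g e ^+ a i e)).
  rewrite big_mkcond; apply: eq_bigr => i _; under eq_bigr do rewrite mulrCA.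
  by rewrite -mulr_sumr functional_monomial mulr_natr mulrb.
rewrite exchange_big big1 // => g /familyP g_in.
rewrite -mulr_sumr; apply/eqP; rewrite mulf_eq0; apply/orP; right.
apply/negPn/negP => nz; apply: no_x; exists (x g) => // e.
by apply: mem_nth; apply: leq_trans (g_in e) (d_lt e).
Qed.

End CombinatorialNullstellensatz.

Definition multiplicity (K T : finType) (h : K -> T) : {ffun T -> nat} :=
  [ffun e => #|[set k | h k == e]|].

Section Multiplicity.
Variables (K T : finType).
Implicit Types h : K -> T.

Lemma prodr_multiplicity (R : comPzRingType) h (x : T -> R) :
  \prod_k x (h k) = \prod_e x e ^+ multiplicity h e.
Proof.
rewrite (partition_big h predT) //=; apply: eq_bigr => e _.
rewrite ffunE -prodr_const; apply: eq_big => [k|k /eqP->//].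
by rewrite inE.
Qed.

Lemma sum_multiplicity h : (\sum_e multiplicity h e = #|K|)%N.
Proof.
rewrite -sum1_card (partition_big h predT) //=; apply: eq_bigr => e _.
by rewrite ffunE -sum1_card; apply: eq_bigl => k; rewrite inE.
Qed.

Lemma multiplicity_some h e :
  multiplicity (some \o h) e = if e is Some e' then multiplicity h e' else 0%N.
Proof.
rewrite ffunE; case: e => [e|]; last by rewrite eq_card0 // => k; rewrite inE.
by rewrite ffunE; apply: eq_card => k; rewrite !inE.
Qed.

End Multiplicity.

Lemma eq_multiplicity_perm (T : finType) (m : nat) (h b : 'I_m -> T) :
  multiplicity h = multiplicity b -> exists s : 'S_m, h =1 b \o s.
Proof.
move=> eq_hb.
have count_tuple (f : 'I_m -> T) e :
    count_mem e [tuple f k | k < m] = multiplicity f e.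
  rewrite ffunE /= count_map -sum1_card -sum1_count big_enum_cond.
  by apply: eq_bigl => k; rewrite inE.
have /tuple_permP[s hE] : perm_eq [tuple h k | k < m] [tuple b k | k < m].
  by apply/allP => e _; rewrite /= !count_tuple eq_hb.
exists s => k; have := congr1 (fun t : m.-tuple T => tnth t k) (val_inj hE).
by rewrite !tnth_mktuple.
Qed.

Section DetLinearCombination.
Variables (m : nat) (T : finType).

Definition det_lincomb_term (R : pzRingType) (C : T -> 'M[R]_m)
    (th : 'S_m * {ffun 'I_m -> T}) : R :=
  (-1) ^+ th.1 * \prod_k C (th.2 k) k (th.1 k).

(* The coefficient of [\prod_e x e ^+ d e] in [\det (\sum_e x e *: C e)]. *)
Definition det_lincomb_coef (R : pzRingType) (C : T -> 'M[R]_m)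
    (d : {ffun T -> nat}) : R :=
  \sum_(th : 'S_m * {ffun 'I_m -> T} | multiplicity th.2 == d)
    det_lincomb_term C th.

Lemma det_lincomb (R : comPzRingType) (C : T -> 'M[R]_m) (x : T -> R) :
  \det (\sum_e x e *: C e) =
  \sum_th det_lincomb_term C th * \prod_e x e ^+ multiplicity th.2 e.
Proof.
rewrite -(pair_bigA _ (fun t h => det_lincomb_term C (t, h) *
  \prod_e x e ^+ multiplicity h e)).
apply: eq_bigr => t _; under [RHS]eq_bigr do rewrite -mulrA /=.
rewrite -mulr_sumr; congr (_ * _).
transitivity (\prod_k \sum_e C e k (t k) * x e).
  apply: eq_bigr => k _; rewrite summxE; apply: eq_bigr => e _.
  by rewrite mxE mulrC.
rewrite bigA_distr_bigA; apply: eq_bigr => h _.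
by rewrite big_split -prodr_multiplicity.
Qed.

Lemma exists_det_lincomb_neq0 (F : fieldType) (C : T -> 'M[F]_m)
    (d : {ffun T -> nat}) (s : T -> seq F) :
    (\sum_e d e = m)%N -> det_lincomb_coef C d != 0 ->
    (forall e, uniq (s e)) -> (forall e, d e < size (s e))%N ->
  exists2 x : T -> F, forall e, x e \in s e & \det (\sum_e x e *: C e) != 0.
Proof.
move=> d_sum coef_neq0 s_uniq d_lt.
have [th|x x_in] := combinatorial_nullstellensatz s_uniq d_lt _ coef_neq0.
  by rewrite sum_multiplicity card_ord d_sum.
by exists x; rewrite // det_lincomb.
Qed.

Section WeightedLeadingTerm.
Variables (R : idomainType) (C : T -> 'M[R]_m) (b : 'I_m -> T).
Variables row_weight col_weight : 'I_m -> nat.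
Hypothesis C_weight : forall a k l, C (b a) k l != 0 ->
  (row_weight k + col_weight l <= row_weight a + col_weight a
     ?= iff (b k == b a) && (k == l))%N.

Let leading : 'S_m * {ffun 'I_m -> T} := (1%g, [ffun k => b k]).

Lemma leading_term_unique (th : 'S_m * {ffun 'I_m -> T}) :
    multiplicity th.2 = multiplicity b -> det_lincomb_term C th != 0 ->
  th = leading.
Proof.
case: th => t h /= /eq_multiplicity_perm[s hE].
rewrite mulf_eq0 signr_eq0 => /prodf_neq0 /= C_neq0.
have weight_le k : true ->
    (row_weight k + col_weight (t k) <= row_weight (s k) + col_weight (s k)
       ?= iff (b k == b (s k)) && (k == t k))%N.
  by move=> _; apply: C_weight; rewrite -[b (s k)]hE C_neq0.
(* Both sides sum to the total weight of all rows and columns. *)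
have : (\sum_k (row_weight k + col_weight (t k)) =
        \sum_k (row_weight (s k) + col_weight (s k)))%N.
  have sum_perm (g : 'I_m -> nat) (u : 'S_m) :
      (\sum_k g (u k) = \sum_k g k)%N.
    by rewrite [RHS](reindex_inj (@perm_inj _ u)).
  by rewrite !big_split /= !(sum_perm row_weight, sum_perm col_weight).
move/eqP; rewrite (leqif_sum weight_le) => /forallP tight.
congr (_, _).
  by apply/permP => k; rewrite perm1; have /andP[_ /eqP <-] := tight k.
by apply/ffunP => k; rewrite ffunE hE /=; have /andP[/eqP <-] := tight k.
Qed.

Lemma det_lincomb_coef_leading :
  det_lincomb_coef C (multiplicity b) = \prod_k C (b k) k k.
Proof.
rewrite /det_lincomb_coef (bigD1 leading) /=; last first.
  apply/eqP/ffunP => e; rewrite !ffunE.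
  by apply: eq_card => k; rewrite !inE ffunE.
rewrite big1 => [|th /andP[/eqP th_mult]]; last first.
  by apply: contraNeq => /(leading_term_unique th_mult)->.
rewrite addr0 /det_lincomb_term odd_perm1 mul1r.
by apply: eq_bigr => k _; rewrite ffunE perm1.
Qed.

End WeightedLeadingTerm.
End DetLinearCombination.

Lemma minor_neq0_le_rank (F : fieldType) (m n r : nat) (f : 'I_r -> 'I_m)
    (g : 'I_r -> 'I_n) (X : 'M[F]_(m, n)) :
  \det (mxsub f g X) != 0 -> (r <= \rank X)%N.
Proof.
rewrite -unitfE -unitmxE -row_free_unit => /eqP {1}<-.
rewrite mxsubrc rowsubE; apply: leq_trans (mxrankM_maxr _ _) _.
by rewrite -{1}[X]mulmx1 -mulmx_colsub mxrankM_maxl.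
Qed.

Section RankOfLinearCombinations.
Variables (F : fieldType) (m n r : nat) (f : 'I_r -> 'I_m) (g : 'I_r -> 'I_n).
Variables (row_weight : 'I_m -> nat) (col_weight : 'I_n -> nat).

Definition leading_entries (T : finType) (D : T -> 'M[F]_(m, n))
    (b : 'I_r -> T) : Prop :=
  (forall k, D (b k) (f k) (g k) != 0) /\
  (forall a k l, D (b a) (f k) (g l) != 0 ->
    (row_weight (f k) + col_weight (g l) <= row_weight (f a) + col_weight (g a)
       ?= iff (b k == b a) && (k == l))%N).

Lemma exists_lincomb_rank_ge (T : finType) (D : T -> 'M[F]_(m, n))
    (b : 'I_r -> T) (s : T -> seq F) :
    leading_entries D b ->
    (forall e, uniq (s e)) -> (forall e, multiplicity b e < size (s e))%N ->
  exists2 x : T -> F, forall e, x e \in s e &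
    (r <= \rank (\sum_e x e *: D e)%R)%N.
Proof.
move=> [D_neq0 D_weight] s_uniq b_lt; pose C e := mxsub f g (D e).
have [||x x_in det_neq0] := exists_det_lincomb_neq0 (C := C) _ _ s_uniq b_lt.
- by rewrite sum_multiplicity card_ord.
- rewrite (@det_lincomb_coef_leading _ _ _ C b (row_weight \o f)
    (col_weight \o g)) => [|a k l]; last by rewrite mxE => /D_weight.
  by apply/prodf_neq0 => k _; rewrite mxE.
exists x => //; apply: (@minor_neq0_le_rank _ _ _ _ f g).
by rewrite linear_sum; under eq_bigr do rewrite linearZ.
Qed.

(* [A] is treated as the coefficient of one more variable, of exponent 0 in the
   leading monomial, whose grid is reduced to the value 1. *)
Lemma exists_affine_rank_ge (T : finType) (A : 'M[F]_(m, n))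
    (D : T -> 'M[F]_(m, n)) (b : 'I_r -> T) (s : T -> seq F) :
    leading_entries D b ->
    (forall e, uniq (s e)) -> (forall e, multiplicity b e < size (s e))%N ->
  exists2 x : T -> F, forall e, x e \in s e &
    (r <= \rank (A + \sum_e x e *: D e)%R)%N.
Proof.
move=> D_leading s_uniq b_lt.
pose D' o := if o is Some e then D e else A.
pose s' o := if o is Some e then s e else [:: 1].
have [//|[e|//]|o|x x_in rank_ge] :=
    @exists_lincomb_rank_ge _ D' (some \o b) s'.
- exact: s_uniq.
- by rewrite multiplicity_some; case: o.
exists (fun e => x (Some e)) => [e|]; first exact: (x_in (Some e)).
apply: leq_trans rank_ge _.
have x_None : x None = 1 by apply/eqP; have := x_in None; rewrite inE.
rewrite (bigD1 None) //= x_None scale1r (reindex_omap Some id) => [|[]//] /=.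
by under eq_bigl do rewrite eqxx.
Qed.

End RankOfLinearCombinations.

Lemma eq_set2 (T : finType) (a b c d : T) :
  ([set a; b] == [set c; d]) = (a == c) && (b == d) || (a == d) && (b == c).
Proof.
apply/eqP/orP => [eq_sets|[]/andP[/eqP-> /eqP->]//]; last exact: setUC.
have := set21 a b; have := set22 a b; rewrite eq_sets !in_set2.
have := set21 c d; have := set22 c d; rewrite -eq_sets !in_set2.
do 4![case/orP=> /eqP ?]; subst; rewrite ?eqxx; auto.
Qed.

Section Mate.
Variables (T : finType) (M : {set {set T}}).
Hypothesis M_triv : trivIset M.
Hypothesis M_le2 : forall e, e \in M -> (#|e| <= 2)%N.

(* A vertex covered by a loop is its own mate. *)
Definition mate (x : T) : T := odflt x [pick y in pblock M x :\ x].

Lemma pblock_mate x : x \in cover M -> pblock M x = [set x; mate x].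
Proof.
move=> xM; have x_in : x \in pblock M x by rewrite mem_pblock.
rewrite /mate; case: pickP => [y|no_y] /=.
  rewrite in_setD1 => /andP[neq_yx y_in]; apply/esym/eqP.
  rewrite eqEcard subUset !sub1set x_in y_in cards2 eq_sym neq_yx.
  exact/M_le2/pblock_mem.
apply/setP => y; rewrite setUid in_set1; have := no_y y; rewrite in_setD1.
by case: eqVneq => [->|_ /= ->].
Qed.

Lemma eq_set2_mate x y z : x \in cover M -> y \in cover M -> z \in cover M ->
  ([set x; mate y] == [set z; mate z]) =
  (pblock M x == pblock M z) && (x == y).
Proof.
move=> xM yM zM; have zM' := pblock_mem zM; rewrite -(pblock_mate zM).
apply/eqP/andP => [xyE|[/eqP<- /eqP<-]]; last by rewrite pblock_mate.
have xz : pblock M x = pblock M z by apply: def_pblock; rewrite // -xyE set21.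
have yz : pblock M y = pblock M z.
  have mate_in : mate y \in pblock M y by rewrite pblock_mate // set22.
  rewrite -(same_pblock M_triv mate_in); apply: def_pblock => //.
  by rewrite -xyE set22.
split; first exact/eqP.
move/eqP: xyE; rewrite -yz pblock_mate // eq_set2.
by case/orP=> /andP[/eqP-> // /eqP->].
Qed.

Lemma multiplicity_pblock_le2 (K : finType) (f : K -> T) e :
    injective f -> (forall k, f k \in cover M) ->
  (multiplicity (pblock M \o f) e <= 2)%N.
Proof.
move=> f_inj fM; rewrite ffunE; set fiber := [set k | _].
have [->|[a]] := set_0Vmem fiber; first by rewrite cards0.
rewrite inE => /eqP eE; apply: leq_trans (M_le2 (e := e) _); last first.
  by rewrite -eE pblock_mem.
rewrite -(card_imset _ f_inj); apply/subset_leq_card/subsetP.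
move=> _ /imsetP[k + ->].
by rewrite inE => /eqP <-; rewrite mem_pblock.
Qed.

End Mate.

Lemma colex_lt_weight (n : nat) (p r : 'I_n * 'I_n) :
    (p.1 <= p.2)%N -> colex_lt p r ->
  (2 ^ p.1 + 2 ^ p.2 < 2 ^ r.1 + 2 ^ r.2)%N.
Proof.
move=> le_p /orP[lt2|/andP[/eqP-> lt1]]; last by rewrite ltn_add2r ltn_exp2l.
apply: leq_ltn_trans (_ : 2 ^ r.2 < _)%N; last first.
  by rewrite -[ltnLHS]add0n ltn_add2r expn_gt0.
apply: leq_trans (_ : 2 ^ p.2.+1 <= _)%N; last by rewrite leq_exp2l.
by rewrite expnS mul2n -addnn leq_add2r leq_exp2l.
Qed.

Lemma qtilde_weight (F : fieldType) (n : nat) (Y : 'M[F]_n) (x y : 'I_n) :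
    weakly_symmetric Y -> Y != 0 -> qtilde Y = [set x; y] ->
  Y x y != 0 /\ forall u v, Y u v != 0 ->
    (2 ^ u + 2 ^ v <= 2 ^ x + 2 ^ y ?= iff ([set u; v] == [set x; y]))%N.
Proof.
move=> wsY Y_neq0; have [[i j] qE [ij_in ij_max]] := qmaxP wsY Y_neq0.
rewrite /qtilde qE => ij_xy.
move: ij_in; rewrite inE /= => /andP[le_ij Yij].
have weight_set2 (a b c d : 'I_n) : [set a; b] == [set c; d] ->
    (2 ^ a + 2 ^ b = 2 ^ c + 2 ^ d)%N.
  by rewrite eq_set2 => /orP[]/andP[/eqP-> /eqP->] //; rewrite addnC.
have sorted_weight (u v : 'I_n) : (u <= v)%N -> Y u v != 0 ->
    (2 ^ u + 2 ^ v <= 2 ^ i + 2 ^ j ?= iff ([set u; v] == [set i; j]))%N.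
  move=> le_uv Yuv; have [[-> ->]|neq] := eqVneq (u, v) (i, j).
    by split; rewrite ?eqxx.
  have lt_uv : (2 ^ u + 2 ^ v < 2 ^ i + 2 ^ j)%N.
    apply: (@colex_lt_weight _ (u, v) (i, j)) => //.
    by apply: ij_max; rewrite // inE /= le_uv.
  split; first exact: ltnW.
  rewrite ltn_eqF //; apply/esym/negP => /weight_set2 eq_weight.
  by rewrite eq_weight ltnn in lt_uv.
split.
  move/eqP: ij_xy; rewrite eq_set2 => /orP[]/andP[/eqP<- /eqP<-] //.
  exact/wsY.
rewrite -(weight_set2 i j x y) -?ij_xy // => u v Yuv.
have [|/ltnW] := leqP u v; first by move/sorted_weight; apply.
by rewrite addnC setUC => /sorted_weight; apply; apply/wsY.
Qed.

Lemma exists_matching_rank_ge (F : fieldType) (n : nat) (A : 'M[F]_n)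
    (M : {set {set 'I_n}}) (Y : {set 'I_n} -> 'M[F]_n) (s : seq F) :
    uniq s -> (2 < size s)%N -> matching M ->
    (forall e, e \in M ->
      [/\ weakly_symmetric (Y e), Y e != 0 & qtilde (Y e) = e]) ->
  exists x : {set 'I_n} -> F,
    (#|cover M| <= \rank (A + \sum_e x e *: Y e)%R)%N.
Proof.
move=> s_uniq s_gt2 /andP[/subsetP M_loop M_triv] Y_lead.
have M_le2 e : e \in M -> (#|e| <= 2)%N by move/M_loop; rewrite inE => /andP[].
pose f k : 'I_n := @enum_val _ (mem (cover M)) k.
have f_in k : f k \in cover M := enum_valP k.
have f_inj : injective f := @enum_val_inj _ _.
pose pow2 (u : 'I_n) := (2 ^ u)%N.
pose g := mate M \o f; pose edge := pblock M \o f.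
have edgeE k : edge k = [set f k; g k] := pblock_mate M_le2 (f_in k).
have edge_lead k : Y (edge k) (f k) (g k) != 0 /\
    forall u v, Y (edge k) u v != 0 ->
      (pow2 u + pow2 v <= pow2 (f k) + pow2 (g k)
         ?= iff ([set u; v] == [set f k; g k]))%N.
  have [wsY Y_neq0 qY] := Y_lead _ (pblock_mem (f_in k)).
  by apply: qtilde_weight; rewrite -?edgeE.
have Y_leading : leading_entries f g pow2 pow2 Y edge.
  split=> [k|a k l /(edge_lead a).2]; first exact: (edge_lead k).1.
  by rewrite (eq_set2_mate M_triv M_le2) // (inj_eq f_inj).
have [//|e|x _ rank_ge] :=
    exists_affine_rank_ge A (s := fun=> s) Y_leading.
  exact: leq_ltn_trans (multiplicity_pblock_le2 M_le2 e f_inj f_in) s_gt2.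
by exists x.
Qed.

Lemma rank_le_max_rank (F : fieldType) (n : nat) (S : 'M[F]_n -> Prop)
    (X : 'M[F]_n) :
  S X -> (\rank X <= max_rank S)%N.
Proof.
move=> SX; have rank_lt : (\rank X < n.+1)%N := rank_leq_row X.
by apply: (@leq_bigmax_cond _ _ _ (Ordinal rank_lt)); apply/asboolP; exists X.
Qed.

Theorem theorem1p1 (F : fieldType) (n : nat) (A : 'M[F]_n)
    (B : {vspace 'M[F]_n})
    (cardF : exists s : seq F, uniq s /\ (3 <= size s)%N)
    (BW : forall Y : 'M[F]_n, Y \in B -> weakly_symmetric Y) :
  (max_rank (affine_set A B) >= mu (affine_graph B))%N.
Proof.
have [s [s_uniq s_gt2]] := cardF.
apply/bigmax_leqP => M /andP[/subsetP MG M_matching].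
have /andP[_ /eqP->] := M_matching.
have /fin_all_exists[Y YP] e : exists Z : 'M[F]_n,
    Z \in B /\ (e \in M -> Z != 0 /\ qtilde Z = e).
  have [/MG|] := boolP (e \in M); last by exists 0; rewrite mem0v.
  by rewrite inE => /asboolP[Z [ZB Z_neq0 qZ]]; exists Z.
have [e eM|x rank_ge] :=
    exists_matching_rank_ge A (Y := Y) s_uniq s_gt2 M_matching.
  by have [/BW wsY /(_ eM)[]] := YP e.
apply: leq_trans rank_ge (rank_le_max_rank _).
exists (\sum_e x e *: Y e) => //.
by apply: memv_suml => e _; apply: memvZ; case: (YP e).
Qed.
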